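(* Let $\mathcal{P}=\Gamma(S)$ be a crystallographic sphere packing in $\mathbb{R}^{1,N-1}$, and let $k\ge1$. Suppose there exist an element $\nu$ of $\mathcal{P}$ and a reflective subgroup $\langle R_{\alpha_1},\dots,R_{\alpha_k}\rangle$ of $\Gamma$ whose Coxeter graph is a path $T_k$ with $k$ nodes $\alpha_1,\dots,\alpha_k$, with $\nu$ attached to the end node $\alpha_1$ by a bold edge (and to no other node). That is, after positive scaling so that $\nu\cdot\nu=-2$ and $\alpha_i\cdot\alpha_i=-2$ for all $i$: $\alpha_i\cdot\alpha_{i+1}=1$ for $1\le i<k$, $\alpha_i\cdot\alpha_j=0$ for $|i-j|\ge2$, $\nu\cdot\alpha_1=2$, and $\nu\cdot\alpha_i=0$ for $i\ge2$. Then $\mathcal{P}$ includes a cluster of $k+1$ mutually tangent spheres.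
   Context: $\mathbb{R}^{1,N-1}$ is an $N$-dimensional real vector space with a symmetric bilinear form $\mathbf u\cdot\mathbf v$ of signature $(1,N-1)$. $\mathcal{H}$ is one sheet of $\{\mathbf x\cdot\mathbf x=1\}$, a model of $\mathbb{H}^{N-1}$. $\mathcal{O}^+$ is the group of linear maps preserving the form and $\mathcal{H}$; for a lattice $\Lambda$ (the $\mathbb Z$-span of a basis), $\mathcal{O}^+_\Lambda=\{T\in\mathcal{O}^+:T\Lambda=\Lambda\}$. For $\mathbf n\cdot\mathbf n<0$, $R_{\mathbf n}(\mathbf x)=\mathbf x-2\frac{\mathbf n\cdot\mathbf x}{\mathbf n\cdot\mathbf n}\mathbf n$ is reflection in the hyperplane $\mathbf n\cdot\mathbf x=0$; the vector $\mathbf n$ represents a hyperplane in $\mathbb{H}^{N-1}$ and hence a sphere on its boundary. A set $\mathcal{P}\subset\mathbb{R}^{1,N-1}$ is a packing if there is a constant $c>0$ with $\mathbf n\cdot\mathbf n=-c$ for all $\mathbf n\in\mathcal{P}$ and $\mathbf n\cdot\mathbf n'\ge c$ for distinct $\mathbf n,\mathbf n'\in\mathcal{P}$; two distinct elements (spheres) are tangent when $\mathbf n\cdot\mathbf n'=c$. A packing is crystallographic if there are a lattice $\Lambda$, a group $\Gamma\le\mathcal{O}_\Lambda^+$ having a convex fundamental domain in $\mathcal{H}$ with finitely many faces, and a finite set $S\subset\Lambda$ such that $\mathcal{P}=\Gamma(S)=\{\gamma(\mathbf n):\gamma\in\Gamma,\mathbf n\in S\}$, where each vector is understood up to positive scaling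 (so vectors in different orbits are normalized to have equal norm). In a Coxeter graph, a simple edge joins vectors whose hyperplanes meet at angle $\pi/3$, non-adjacent nodes are orthogonal, and a bold edge means the hyperplanes are parallel (tangent at infinity). *)

(* Defs.v *)
From HB Require Import structures.
From mathcomp Require Import all_boot all_order all_algebra.
From mathcomp Require Import all_classical all_reals all_analysis.

Set Implicit Arguments.
Unset Strict Implicit.
Unset Printing Implicit Defensive.
Import Order.TTheory GRing.Theory Num.Theory.
Import numFieldNormedType.Exports.

Local Open Scope classical_set_scope.
Local Open Scope ring_scope.

(* The basis has p + q elements, so this forces p + q = N. *)
Definition has_signature (R : realType) (N : nat)
    (dot : {symmetric 'rV[R]_N}) (p q : nat) : Prop :=
  exists e : (p + q).-tuple 'rV[R]_N,
    basis_of fullv e /\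
    forall i j : 'I_(p + q),
      dot e`_i e`_j = if i != j then 0 else if (i < p)%N then 1 else -1.

Section Geometry.
Variables (R : realType) (N : nat).
Notation V := 'rV[R]_N.
Variable dot : {symmetric V}.

(* The two sheets of {x.x = 1} are separated by the sign of the product with
   any fixed point t of {x.x = 1}; H is the sheet of t. *)
Definition is_sheet (H : set V) : Prop :=
  exists2 t, dot t t = 1 & H = [set x | dot x x = 1 /\ 0 < dot x t].

Definition is_lattice (L : set V) : Prop :=
  exists e : N.-tuple V,
    basis_of fullv e /\
    L = [set \sum_(i < N) e`_i *~ z i | z in [set: 'I_N -> int]].

Definition linear_group (G : set 'End(V)) : Prop :=
  [/\ G \1%VF,
      forall f g, G f -> G g -> G (f \o g)%VF &
      forall f, G f -> lker f = 0%VS /\ G (f^-1)%VF].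

Definition generated_group (A : set 'End(V)) : set 'End(V) :=
  smallest linear_group A.

Definition Oplus (H : set V) : set 'End(V) :=
  [set T | (forall x y, dot (T x) (T y) = dot x y) /\ T @` H = H].

Definition Oplus_lattice (H L : set V) : set 'End(V) :=
  [set T | Oplus H T /\ T @` L = L].

Definition reflection (n x : V) : V := x - (2 * dot n x / dot n n) *: n.

Fact reflection_is_linear n : linear (reflection n).
Proof.
move=> a x y; rewrite /reflection linearPr /= mulrDr mulrDl scalerDl opprD.
by rewrite addrACA scalerBr scalerA mulrCA !mulrA.
Qed.

HB.instance Definition _ n := GRing.isLinear.Build R V V _ (reflection n)
  (reflection_is_linear n).

(* Finite intersection of closed half-spaces of H (hence geodesically convex).
   The hyperplane n.x = 0 meets H in codimension 1 exactly when n.n < 0. *)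
Definition finite_sided_polyhedron (H F : set V) : Prop :=
  exists2 s : seq V, {in s, forall n, dot n n < 0} &
    F = [set x | H x /\ {in s, forall n, 0 <= dot n x}].

Definition relative_interior (H F : set V) : set V :=
  [set x | H x /\ \forall y \near x, H y -> F y].

Definition fundamental_domain (H : set V) (G : set 'End(V)) (F : set V) : Prop :=
  [/\ F `<=` H,
      relative_interior H F !=set0,
      \bigcup_(g in G) (g @` F) = H &
      forall g, G g -> g <> \1%VF ->
        relative_interior H F `&` (g @` relative_interior H F) = set0].

Definition packing (c : R) (P : set V) : Prop :=
  [/\ 0 < c,
      forall n, P n -> dot n n = - c &
      forall n n', P n -> P n' -> n <> n' -> c <= dot n n'].

Definition tangent (c : R) (n n' : V) : Prop := n <> n' /\ dot n n' = c.

Definition equal_up_to_scaling (P Q : set V) : Prop :=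
  (forall v, P v -> exists2 a, 0 < a & Q (a *: v)) /\
  (forall v, Q v -> exists2 a, 0 < a & P (a *: v)).

Definition orbit_set (G : set 'End(V)) (S : set V) : set V :=
  [set v | exists g n, [/\ G g, S n & v = g n]].

(* P is a packing with constant c that is crystallographic through the data
   L, G, S. *)
Definition crystallographic_packing (H L : set V) (G : set 'End(V))
    (S P : set V) (c : R) : Prop :=
  packing c P /\
  [/\ is_lattice L,
      linear_group G /\ G `<=` Oplus_lattice H L,
      exists F, fundamental_domain H G F /\ finite_sided_polyhedron H F,
      finite_set S /\ S `<=` L &
      equal_up_to_scaling P (orbit_set G S)].

(* Coxeter graph: the path alpha_0 - ... - alpha_(k-1) with nu joined to
   alpha_0 by a bold edge, all vectors being scaled to have norm -2. *)
Definition path_with_bold_end (k : nat) (nu : V) (alpha : 'I_k -> V) : Prop :=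
  [/\ dot nu nu = - 2 /\ forall i, dot (alpha i) (alpha i) = - 2,
      forall i j : 'I_k, i.+1 = j :> nat -> dot (alpha i) (alpha j) = 1,
      forall i j : 'I_k, (i.+1 < j)%N -> dot (alpha i) (alpha j) = 0 &
      forall i : 'I_k, dot nu (alpha i) = if i == 0%N :> nat then 2 else 0].

End Geometry.

(* Main.v *)
Require Import Defs.
From HB Require Import structures.
From mathcomp Require Import all_boot all_order all_algebra.
From mathcomp Require Import all_classical all_reals all_analysis.
From mathcomp Require Import ring lra.
Import Order.TTheory GRing.Theory Num.Theory.
Import numFieldNormedType.Exports.
Local Open Scope classical_set_scope.
Local Open Scope ring_scope.

(** Let [w_0 = nu] and let [w_(j+1)] be the reflection of [w_j] in
[alpha_j] (nodes numbered from 0). By induction [w_j] pairs to 2 with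
[alpha_j] and to 0 with the later nodes, so [w_(j+1) = w_j + 2 alpha_j], and
hence [w_i . w_j = 2] for [i < j]. All the [w_j] are in the orbit of [nu], and
a packing, all of whose elements have the same norm, is stable under its
group. *)

Section SymmetricForm.
Set Implicit Arguments.
Unset Strict Implicit.
Variables (R : realType) (N : nat).
Variable dot : {symmetric 'rV[R]_N}.

Lemma dotC u v : dot u v = dot v u.
Proof. by rewrite hermC expr0 mul1r. Qed.

Lemma dotDl u v w : dot (u + v) w = dot u w + dot v w.
Proof. exact: linearDl. Qed.

Lemma dotZl a u v : dot (a *: u) v = a * dot u v.
Proof. exact: linearZl_LR. Qed.

Lemma dotDr u v w : dot u (v + w) = dot u v + dot u w.
Proof. exact: linearDr. Qed.

Lemma dotZr a u v : dot u (a *: v) = a * dot u v.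
Proof. by rewrite dotC dotZl dotC. Qed.

(** The Coxeter graph constrains rescaled nodes, whereas the group contains the reflections in the
    original ones; this identifies the two. *)
Lemma reflectionZ b n x : b != 0 ->
  reflection dot (b *: n) x = reflection dot n x.
Proof.
move=> b0; rewrite /reflection !dotZl dotZr scalerA; congr (_ - _ *: _).
(* For isotropic [n] the convention that 0 has inverse 0 makes both coefficients vanish. *)
have [->|n0] := eqVneq (dot n n) 0; first by rewrite !mulr0 invr0 !mulr0 mul0r.
by field; rewrite b0 n0.
Qed.

(** As [P] is an orbit set only up to positive scaling, what is immediate is that some positive
    multiple of [T n] lies in [P]. Since [T] is an isometry and all elements of [P] have norm [- c],
    the square of that factor is 1, so the factor is 1. *)
Lemma packing_orbit_stable (H L : set 'rV[R]_N) (G : set 'End('rV[R]_N))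
    (S P : set 'rV[R]_N) (c : R) (T : 'End('rV[R]_N)) (n : 'rV[R]_N) :
  crystallographic_packing dot H L G S P c -> G T -> P n -> P (T n).
Proof.
move=> [[c0 Pn _] [_ [[_ GM _] GO] _ _ [PS SP]]] GT nP.
have [a a0 [g [s [Gg Ss ags]]]] := PS _ nP.
(* Here [a *: n = g s], so [a *: T n] is the image of [s] under the composite of [T] and [g]. *)
have [b b0 bP] : exists2 b, 0 < b & P (b *: (a *: T n)).
  apply: SP; exists (T \o g)%VF, s; rewrite comp_lfunE -ags linearZ.
  by split=> //; exact: GM.
have Tn : dot (T n) (T n) = - c by have [[-> _] _] := GO _ GT; exact: Pn.
have := Pn _ bP; rewrite scalerA dotZl dotZr Tn => ba2.
have {}ba2 : (b * a) ^+ 2 = 1.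
  by apply: (mulIf (lt0r_neq0 c0)); lra.
have ba1 : b * a = 1.
  by apply/eqP; rewrite -(@pexpr_eq1 _ _ 2) ?ba2// ltW// mulr_gt0.
by move: bP; rewrite scalerA ba1 scale1r.
Qed.

Section PathCluster.
Variables (k : nat) (nu : 'rV[R]_N) (alpha : 'I_k -> 'rV[R]_N).
Hypothesis path_alpha : path_with_bold_end dot nu alpha.

(** Closed form of the successive images of [nu]. The index is a natural number because [n = k],
    which is not a node, gives the last of the [k.+1] vertices. *)
Definition cluster_vertex (n : nat) : 'rV[R]_N :=
  nu + \sum_(i < k | (i < n)%N) 2 *: alpha i.

Lemma cluster_vertex0 : cluster_vertex 0 = nu.
Proof. by rewrite /cluster_vertex big_pred0 ?addr0. Qed.

Lemma cluster_vertexS (j : 'I_k) :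
  cluster_vertex j.+1 = cluster_vertex j + 2 *: alpha j.
Proof.
rewrite /cluster_vertex (bigD1 j)//= addrA addrAC; congr (_ + _ + _).
by apply: eq_bigl => i; rewrite ltnS andbC -ltn_neqAle.
Qed.

(** Adding [2 *: alpha n] raises the product with the next node from 0 to 2 and leaves those with
    later nodes at 0. *)
Lemma dot_cluster_vertex_node (n : nat) (i : 'I_k) : (n <= i)%N ->
  dot (cluster_vertex n) (alpha i) = if i == n :> nat then 2 else 0.
Proof.
have [_ adj far nua] := path_alpha.
elim: n => [|n IHn] ni; first by rewrite cluster_vertex0 nua.
pose j := Ordinal (ltn_trans ni (ltn_ord i)).
rewrite (cluster_vertexS j) dotDl dotZl IHn ?(ltnW ni)// gtn_eqF// add0r.
have [ji|ji] := eqVneq (i : nat) n.+1; first by rewrite adj ?mulr1.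
by rewrite far ?mulr0// ltn_neqAle eq_sym ji.
Qed.

Lemma cluster_vertex_reflection (j : 'I_k) :
  cluster_vertex j.+1 = reflection dot (alpha j) (cluster_vertex j).
Proof.
have [[_ norm_alpha] _ _ _] := path_alpha.
rewrite cluster_vertexS /reflection dotC dot_cluster_vertex_node// eqxx.
(* The reflection coefficient is -(2 * 2 / -2) = 2. *)
rewrite norm_alpha -scaleNr; congr (_ + _ *: _); by field.
Qed.

Lemma norm_cluster_vertex (n : nat) : (n <= k)%N ->
  dot (cluster_vertex n) (cluster_vertex n) = - 2.
Proof.
have [[norm_nu norm_alpha] _ _ _] := path_alpha.
elim: n => [|n IHn] nk; first by rewrite cluster_vertex0.
have := @dot_cluster_vertex_node n (Ordinal nk) (leqnn n); rewrite eqxx /=.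
have := IHn (ltnW nk); rewrite (cluster_vertexS (Ordinal nk)) /=.
move: (cluster_vertex n) => w ww wn.
rewrite !(dotDl, dotDr, dotZl, dotZr) ww (dotC (alpha _)) wn norm_alpha; lra.
Qed.

Lemma dot_cluster_vertices (m n : nat) : (m < n)%N -> (n <= k)%N ->
  dot (cluster_vertex m) (cluster_vertex n) = 2.
Proof.
elim: n => // n IHn; rewrite ltnS => mn nk.
rewrite (cluster_vertexS (Ordinal nk)) dotDr dotZr.
rewrite dot_cluster_vertex_node//=.
(* For [m < n] the new node is orthogonal to vertex [m]; for [m = n] the product is -2 + 2 * 2 =
   2. *)
case: ltngtP mn => // [mn _|-> _]; first by rewrite IHn ?(ltnW nk)//; lra.
by rewrite norm_cluster_vertex ?(ltnW nk)//; lra.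
Qed.

End PathCluster.
End SymmetricForm.

Theorem theorem3p1 (R : realType) (N : nat) (dot : {symmetric 'rV[R]_N})
  (hdot : has_signature dot 1 N.-1)
  (H : set 'rV[R]_N) (hH : is_sheet dot H)
  (L : set 'rV[R]_N) (G : set 'End('rV[R]_N)) (S P : set 'rV[R]_N) (c : R)
  (hP : crystallographic_packing dot H L G S P c)
  (k : nat) (hk : (0 < k)%N)
  (nu : 'rV[R]_N) (hnu : P nu) (alpha : 'I_k -> 'rV[R]_N)
  (hG : generated_group
          [set linfun (reflection dot (alpha i)) | i in [set: 'I_k]] `<=` G)
  (hgraph : exists (a : R) (b : 'I_k -> R),
     [/\ 0 < a, forall i, 0 < b i &
         path_with_bold_end dot (a *: nu) (fun i => b i *: alpha i)]) :
  exists C : set 'rV[R]_N,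
    [/\ C `<=` P, (C #= `I_k.+1)%card &
        forall u v, C u -> C v -> u <> v -> tangent dot c u v].
Proof.
have [a [b [a0 b0 path_ab]]] := hgraph.
set beta := fun i => b i *: alpha i in path_ab.
have [[nunu _] _ _ _] := path_ab.
(* Comparing the norms of [nu] and [a *: nu] gives [a * (a * c) = 2]; hence scaling back by [a^-1]
   turns the product 2 into the tangency value [c]. *)
have a2c : a^-1 * (a^-1 * 2) = c.
  have [[_ /(_ _ hnu) norm_nu _] _] := hP.
  move: nunu; rewrite dotZl dotZr norm_nu => nunu.
  have -> : 2 = a * (a * c) by lra.
  by field; rewrite gt_eqF.
pose w n := a^-1 *: cluster_vertex (a *: nu) beta n.
have wP n : (n <= k)%N -> P (w n).
  elim: n => [|n IHn] nk.
    by rewrite /w cluster_vertex0 scalerA mulVf ?gt_eqF// scale1r.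
  pose j := Ordinal nk.
  have -> : w n.+1 = linfun (reflection dot (alpha j)) (w n).
    rewrite lfunE /= linearZ /w (cluster_vertex_reflection path_ab j) /=.
    by rewrite reflectionZ// gt_eqF.
  apply: (packing_orbit_stable hP); last exact/IHn/ltnW.
  by apply: hG; apply: sub_gen_smallest; exists j.
have w_tangent m n : (m < n)%N -> (n <= k)%N -> dot (w m) (w n) = c.
  by move=> mn nk; rewrite dotZl dotZr (dot_cluster_vertices path_ab).
have c0 : 0 < c by have [[]] := hP.
have w_neq m n : (m < n)%N -> (n <= k)%N -> w m <> w n.
  move=> mn nk wmn; have := w_tangent _ _ mn nk.
  have [[_ norm_P _] _] := hP.
  (* Equal vertices would have product both [c] and [- c], against [0 < c]. *)
  by rewrite wmn norm_P => [cc|]; [lra|exact: wP].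
exists (w @` `I_k.+1); split.
- by move=> _ [n /= nk <-]; exact: wP.
- apply: inj_card_eq => m n /[!inE] /= mk nk wmn.
  by have [mn|nm|//] := ltngtP m n; [case: (w_neq m n)|case: (w_neq n m)].
- move=> _ _ [m /= mk <-] [n /= nk <-] wmn; split=> //.
  have [mn|nm|mn] := ltngtP m n; first exact: w_tangent.
    by rewrite dotC; exact: w_tangent.
  by rewrite mn in wmn.
Qed.
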